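(* Let $\alpha,\beta>-1$ be real numbers, $\omega(x)=(1-x)^{\alpha}(1+x)^{\beta}$, and let $\{\tilde P_n^{(\alpha,\beta)}\}_{n\ge0}$ be the sequence of multiplicative Jacobi polynomials. The following properties hold. 1. For $n\ge 0$, $\displaystyle \frac{d^*}{dx}\left(\tilde P_n^{(\alpha,\beta)}(x)\right)=\left(\tilde P_{n-1}^{(\alpha+1,\beta+1)}(x)\right)^{\frac12(n+\alpha+\beta+1)}$ and $\displaystyle \frac{d}{dx}\left(\tilde P_n^{(\alpha,\beta)}(x)\right)=\frac12(n+\alpha+\beta+1)\,P_{n-1}^{(\alpha+1,\beta+1)}(x)\,\tilde P_n^{(\alpha,\beta)}(x)$. 2. (Multiplicative Rodrigues' formula) For $n\ge0$ and $x\in(-1,1)$, $$\tilde P_n^{(\alpha,\beta)}(x)=\left[\frac{d^{*(n)}}{dx^n}\left(e^{(1-x^2)^n\omega(x)}\right)\right]^{\frac{1}{(-1)^n\,n!\,2^n\,\omega(x)}} .$$ 3. (Three-term multiplicative recurrence relation) For $n\ge1$, $$\left(\tilde P_n^{(\alpha,\beta)}(x)\right)^{A(n,\alpha,\beta)}=\frac{\left(\tilde P_{n-1}^{(\alpha,\beta)}(x)\right)^{B(x,n,\alpha,\beta)}}{\left(\tilde P_{n-2}^{(\alpha,\beta)}(x)\right)^{C(n,\alpha,\beta)}},$$ with $\tilde P_0^{(\alpha,\beta)}(x)=e$, $\tilde P_{-1}^{(\alpha,\beta)}(x)=1$, where $A(n,\alpha,\beta)=2n(n+\alpha+\beta)(2n+\alpha+\beta-2)$,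 $B(x,n,\alpha,\beta)=(2n+\alpha+\beta-1)\left[(2n+\alpha+\beta)(2n+\alpha+\beta-2)x+\alpha^2-\beta^2\right]$, $C(n,\alpha,\beta)=2(n+\alpha-1)(n+\beta-1)(2n+\alpha+\beta)$. 4. For $n\ge0$, $\tilde P_n^{(\alpha,\beta)}(1)=e^{\binom{n+\alpha}{n}}$ and $\tilde P_n^{(\alpha,\beta)}(-x)=\left(\tilde P_n^{(\beta,\alpha)}(x)\right)^{(-1)^n}$. 5. For $n\ge0$, $\tilde P_n^{(\alpha,\beta)}$ is a multiplicative polynomial of degree $n$ whose leading coefficient is $\tilde k_n=e^{\frac{1}{2^n}\binom{2n+\alpha+\beta}{n}}$.
   Context: Jacobi polynomials ($\alpha,\beta>-1$): $P_{-1}^{(\alpha,\beta)}=0$, $P_0^{(\alpha,\beta)}=1$ and for $n\ge1$ $$P_n^{(\alpha,\beta)}(x)=\frac{1}{n!}\left[(\alpha+1)_n+\sum_{k=1}^{n}\binom{n}{k}(\alpha+\beta+n+1)_k\frac{(\alpha+1)_n}{(\alpha+1)_k}\left(\frac{x-1}{2}\right)^k\right],$$ with $(c)_0=1$, $(c)_n=c(c+1)\cdots(c+n-1)$. Multiplicative Jacobi polynomials: $\tilde P_n^{(\alpha,\beta)}(x)=e^{P_n^{(\alpha,\beta)}(x)}$ (so $\tilde P_{-1}^{(\alpha,\beta)}=1$). For a positive function $f$, the multiplicative derivative is $\frac{d^*}{dx}f(x)=\lim_{h\to0}[f(x+h)/f(x)]^{1/h}=e^{(\ln f)'(x)}$,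 and the $n$-th multiplicative derivative is $\frac{d^{*(n)}}{dx^n}f(x)=e^{(\ln f)^{(n)}(x)}$. Generalized binomial coefficient: $\binom{z}{n}=\frac{z(z-1)\cdots(z-n+1)}{n!}$ for real $z$ and integer $n\ge0$. A multiplicative polynomial of degree $n$ with leading coefficient $c_n$ is a function $\prod_{k=0}^n (c_k)^{x^k}$ with $c_k\in(0,\infty)$ and $c_n\neq 1$. *)

(* Defs.v *)
From Stdlib Require Export Reals ZArith.
From Coquelicot Require Export Coquelicot.
Open Scope R_scope.

Fixpoint pochhammer (c : R) (n : nat) : R :=
  match n with
  | O => 1
  | S m => pochhammer c m * (c + INR m)
  end.

Fixpoint falling (z : R) (n : nat) : R :=
  match n with
  | O => 1
  | S m => falling z m * (z - INR m)
  end.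

Definition gbinom (z : R) (n : nat) : R := falling z n / INR (fact n).

(* [Binomial.C] is qualified because Coquelicot uses [C] for the complex
   numbers. *)
Definition jacobi_formula (alpha beta : R) (n : nat) (x : R) : R :=
  / INR (fact n) *
  (pochhammer (alpha + 1) n +
   sum_f 1 n (fun k =>
     Binomial.C n k * pochhammer (alpha + beta + INR n + 1) k
     * (pochhammer (alpha + 1) n / pochhammer (alpha + 1) k)
     * ((x - 1) / 2) ^ k)).

(* The degree is an integer because the index -1 is used, with P_{-1} = 0;
   the indices below -1 carry no meaning and are also sent to 0. *)
Definition jacobi (alpha beta : R) (n : Z) (x : R) : R :=
  match n with
  | Zneg _ => 0
  | Z0 => 1
  | Zpos p => jacobi_formula alpha beta (Pos.to_nat p) x
  end.

Definition mjacobi (alpha beta : R) (n : Z) (x : R) : R :=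
  exp (jacobi alpha beta n x).

(* Meaningful for -1 < x < 1 only: [Rpower] requires a positive base. *)
Definition jacobi_weight (alpha beta x : R) : R :=
  Rpower (1 - x) alpha * Rpower (1 + x) beta.

(* For f positive; [is_lim] at 0 ignores the value at h = 0. *)
Definition is_mderive (f : R -> R) (x l : R) : Prop :=
  is_lim (fun h => Rpower (f (x + h) / f x) (1 / h)) 0 l.

Definition mderive_n (f : R -> R) (n : nat) (x : R) : R :=
  exp (Derive_n (fun y => ln (f y)) n x).

(* [Derive_n] is total, so [ex_derive_n] at order n alone would not ensure that
   the derivatives of lower order exist around x. *)
Definition ex_mderive_n (f : R -> R) (n : nat) (x : R) : Prop :=
  locally x (fun y => forall k, (k < n)%nat ->
    ex_derive_n (fun t => ln (f t)) k y) /\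
  ex_derive_n (fun t => ln (f t)) n x.

(* The limit defining [is_mderive] agrees with [mderive_n] at order 1. *)
Lemma is_mderive_mderive_1 (f : R -> R) (x : R) :
  (forall y, 0 < f y) -> ex_mderive_n f 1 x -> is_mderive f x (mderive_n f 1 x).
Proof.
intros Hf [_ Hd].
apply Derive_correct, is_derive_Reals in Hd.
unfold is_mderive, mderive_n; simpl.
change (Derive (fun y => ln (f y)) x)
  with (Derive (Derive_n (fun t => ln (f t)) 0) x).
apply (is_lim_ext
  (fun h => exp ((ln (f (x + h)) - ln (f x)) / h))).
- intros h; unfold Rpower; rewrite ln_div by apply Hf.
  f_equal; unfold Rdiv; ring.
- apply filterlim_comp with
    (G := locally (Derive (Derive_n (fun t => ln (f t)) 0) x)).
  + intros P [eps HP].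
    destruct (Hd eps (cond_pos eps)) as [del Hdel].
    exists del; intros h Hh h0.
    apply HP, Hdel; [exact h0|].
    change (Rabs (h - 0) < del) in Hh; now rewrite Rminus_0_r in Hh.
  + apply (continuous_exp _).
Qed.

Definition is_mult_poly (f : R -> R) (n : nat) (lead : R) : Prop :=
  exists c : nat -> R,
    (forall k, (k <= n)%nat -> 0 < c k) /\
    c n <> 1 /\
    c n = lead /\
    forall x, f x = prod_f_R0 (fun k => Rpower (c k) (x ^ k)) n.

Definition rec_A (n alpha beta : R) : R :=
  2 * n * (n + alpha + beta) * (2 * n + alpha + beta - 2).

Definition rec_B (x n alpha beta : R) : R :=
  (2 * n + alpha + beta - 1) *
  ((2 * n + alpha + beta) * (2 * n + alpha + beta - 2) * x
   + alpha ^ 2 - beta ^ 2).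

Definition rec_C (n alpha beta : R) : R :=
  2 * (n + alpha - 1) * (n + beta - 1) * (2 * n + alpha + beta).

(* Main.v *)
(** With [t = (x - 1) / 2] the Jacobi polynomial is a sum of [t ^ k] with
    hypergeometric coefficients, polynomial in [a] and [b]. Comparing
    coefficients gives the lowering relation for the derivative, the three-term
    recurrence, and the raising relation
      (w_(a+1,b+1) P_n^(a+1,b+1))' = - 2 (n + 1) w_(a,b) P_(n+1)^(a,b).
    Iterating the raising relation gives Rodrigues' formula; together with the
    lowering relation it also gives the reflection formula, by a two-step
    induction on the degree. *)
Require Import Defs.
From Stdlib Require Import Reals ZArith Lra Lia.
From Coquelicot Require Import Coquelicot.
Open Scope R_scope.

(** * Pochhammer symbols and falling factorials *)

Lemma pochhammer_S_l (c : R) (n : nat) :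
  pochhammer c (S n) = c * pochhammer (c + 1) n.
Proof.
induction n as [|n IH]; [simpl; ring|].
change (pochhammer c (S (S n))) with (pochhammer c (S n) * (c + INR (S n))).
change (pochhammer (c + 1) (S n)) with (pochhammer (c + 1) n * (c + 1 + INR n)).
rewrite IH, S_INR; ring.
Qed.

Lemma pochhammer_O (c : R) : pochhammer c 0 = 1.
Proof. reflexivity. Qed.

Lemma pochhammer_S_r (c : R) (n : nat) :
  pochhammer c (S n) = pochhammer c n * (c + INR n).
Proof. reflexivity. Qed.

Lemma pochhammer_add (c : R) (m n : nat) :
  pochhammer c (m + n) = pochhammer c m * pochhammer (c + INR m) n.
Proof.
induction n as [|n IH]; [rewrite Nat.add_0_r; simpl; ring|].
rewrite Nat.add_succ_r; simpl pochhammer; rewrite IH, plus_INR; ring.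
Qed.

Lemma pochhammer_pos (c : R) (n : nat) : 0 < c -> 0 < pochhammer c n.
Proof.
intros Hc; induction n as [|n IH]; simpl; [lra|].
apply Rmult_lt_0_compat; [exact IH|]; pose proof (pos_INR n); lra.
Qed.

Lemma falling_pochhammer (z : R) (n : nat) :
  falling z n = pochhammer (z - INR n + 1) n.
Proof.
induction n as [|n IH]; [reflexivity|].
rewrite pochhammer_S_l; simpl falling; rewrite IH, S_INR.
replace (z - (INR n + 1) + 1 + 1) with (z - INR n + 1) by ring; ring.
Qed.

(** * Polynomials given by coefficient sequences *)

Definition poly_sum (a : nat -> R) (n : nat) (t : R) : R :=
  sum_f_R0 (fun k => a k * t ^ k) n.

Definition shift_coef (a : nat -> R) (k : nat) : R :=
  match k with O => 0 | S j => a j end.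

Lemma poly_sum_ext (a b : nat -> R) (n : nat) (t : R) :
  (forall k, (k <= n)%nat -> a k = b k) -> poly_sum a n t = poly_sum b n t.
Proof. intros H; apply sum_eq; intros k Hk; now rewrite H. Qed.

Lemma poly_sum_S (a : nat -> R) (n : nat) (t : R) :
  a (S n) = 0 -> poly_sum a n t = poly_sum a (S n) t.
Proof. unfold poly_sum; intros H; simpl; rewrite H; ring. Qed.

Lemma poly_sum_plus (a b : nat -> R) (n : nat) (t : R) :
  poly_sum a n t + poly_sum b n t = poly_sum (fun k => a k + b k) n t.
Proof.
unfold poly_sum; rewrite <- plus_sum; apply sum_eq; intros k _; ring.
Qed.

Lemma poly_sum_scal (c : R) (a : nat -> R) (n : nat) (t : R) :
  c * poly_sum a n t = poly_sum (fun k => c * a k) n t.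
Proof.
unfold poly_sum; rewrite scal_sum; apply sum_eq; intros k _; ring.
Qed.

Lemma poly_sum_shift (a : nat -> R) (n : nat) (t : R) :
  t * poly_sum a n t = poly_sum (shift_coef a) (S n) t.
Proof.
unfold poly_sum; rewrite (decomp_sum _ (S n)) by lia; simpl pred.
simpl shift_coef; rewrite scal_sum, Rmult_0_l, Rplus_0_l.
apply sum_eq; intros k _; simpl; ring.
Qed.

Lemma is_derive_poly_sum (a : nat -> R) (n : nat) (t : R) :
  is_derive (poly_sum a (S n)) t
    (poly_sum (fun k => INR (S k) * a (S k)) n t).
Proof.
induction n as [|n IH].
- unfold poly_sum; simpl; auto_derive; [trivial|ring].
- apply (is_derive_ext
    (fun u => plus (poly_sum a (S n) u) (a (S (S n)) * u ^ S (S n))));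
    [reflexivity|].
  apply (is_derive_plus (poly_sum a (S n)) _ t
    (poly_sum (fun k => INR (S k) * a (S k)) n t)
    (INR (S (S n)) * a (S (S n)) * t ^ S n)); [exact IH|].
  auto_derive; [trivial|]; simpl; ring.
Qed.

(** Passes from powers of [t = (x - 1) / 2] to powers of [x], as needed for the leading coefficient.
    Induction on the degree writes the polynomial as its constant term plus [t] times a tail of
    lower degree. The vanishing of [c] beyond [n] is part of the induction because the step uses [c]
    at [S n]. *)
Lemma poly_sum_recenter (a : nat -> R) (n : nat) :
  exists c : nat -> R,
    c n = a n / 2 ^ n /\
    (forall k, (n < k)%nat -> c k = 0) /\
    forall x, poly_sum a n ((x - 1) / 2) = poly_sum c n x.
Proof.
revert a; induction n as [|n IH]; intros a.
- exists (fun k => match k with O => a O | _ => 0 end).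
  split; [simpl; field|split].
  + intros [|k] Hk; [lia|reflexivity].
  + intros x; unfold poly_sum; simpl; ring.
- destruct (IH (fun k => a (S k))) as (c & Hn & H0 & Hx).
  (* These are the coefficients of [a O + (x - 1) / 2 * q], where [q] is the tail re-expanded in [x]
     with coefficients [c]. *)
  exists (fun k => (shift_coef c k - c k) / 2 + match k with O => a O | _ => 0 end).
  split; [|split].
  + simpl; rewrite Hn, (H0 (S n)) by lia; field; apply pow_nonzero; lra.
  + intros [|k] Hk; [lia|]; simpl; rewrite !H0 by lia; field.
  + intros x.
    replace (poly_sum a (S n) ((x - 1) / 2)) with
      (a O + (x - 1) / 2 * poly_sum c n x).
    * rewrite <- poly_sum_plus.
      replace (poly_sum (fun k => match k with O => a O | S _ => 0 end) (S n) x)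
        with (a O).
      2:{ unfold poly_sum; rewrite decomp_sum by lia; simpl pred.
          rewrite (sum_eq _ (fun _ => 0)) by (intros; ring).
          rewrite sum_cte; simpl; ring. }
      rewrite (poly_sum_ext (fun k => (shift_coef c k - c k) / 2)
        (fun k => / 2 * shift_coef c k + - / 2 * c k)) by (intros; field).
      rewrite <- poly_sum_plus, <- !poly_sum_scal, <- poly_sum_shift.
      rewrite <- (poly_sum_S c) by (apply H0; lia); field.
    * rewrite <- Hx; unfold poly_sum at 2.
      rewrite decomp_sum by lia; simpl pred; unfold poly_sum.
      rewrite scal_sum; simpl pow at 2; rewrite Rmult_1_r; f_equal.
      apply sum_eq; intros k _; simpl; ring.
Qed.

(** * Hypergeometric coefficients of the Jacobi polynomials *)

(* Coefficient of [t ^ k] in the Jacobi polynomial of degree [k + j], where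
   [t = (x - 1) / 2]. *)
Definition jcoef (a b : R) (k j : nat) : R :=
  pochhammer (a + b + INR (k + j) + 1) k * pochhammer (a + INR k + 1) j
  / (INR (fact k) * INR (fact j)).

(** The test is there because subtraction on [nat] truncates: for [k > n] the value [jcoef a b k 0]
    need not vanish. *)
Definition jacobi_coef (a b : R) (n k : nat) : R :=
  if (k <=? n)%nat then jcoef a b k (n - k) else 0.

Lemma jacobi_coef_add (a b : R) (k j : nat) :
  jacobi_coef a b (k + j) k = jcoef a b k j.
Proof.
unfold jacobi_coef; destruct (Nat.leb_spec k (k + j)); [|lia].
f_equal; lia.
Qed.

Lemma jacobi_coef_gt (a b : R) (n k : nat) :
  (n < k)%nat -> jacobi_coef a b n k = 0.
Proof.
unfold jacobi_coef; intros H; destruct (Nat.leb_spec k n); [lia|reflexivity].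
Qed.

(* Unlike [jacobi], polynomial in [a] and [b], hence meaningful for all real
   parameters. *)
Definition jacobi_sum (a b : R) (n : nat) (t : R) : R :=
  poly_sum (jacobi_coef a b n) n t.

Lemma jacobi_sum_0 (a b t : R) : jacobi_sum a b 0 t = 1.
Proof.
unfold jacobi_sum, poly_sum, jacobi_coef, jcoef; simpl; field.
Qed.

(** The quotient of (a+1)_n by (a+1)_k is (a+k+1)_(n-k); the division is sound because [-1 < a]
    makes (a+1)_k positive. The term [k = 0], separate in the definition, is matched first. *)
Lemma jacobi_jacobi_sum (a b : R) (n : nat) (x : R) :
  -1 < a -> jacobi a b (Z.of_nat n) x = jacobi_sum a b n ((x - 1) / 2).
Proof.
intros Ha; destruct n as [|n]; [now rewrite jacobi_sum_0|].
simpl; rewrite SuccNat2Pos.id_succ.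
unfold jacobi_formula, jacobi_sum, poly_sum.
rewrite decomp_sum by lia; simpl pred.
pose proof (INR_fact_neq_0 (S n)) as Hf.
rewrite Rmult_plus_distr_l; f_equal.
- change (S n) with (0 + S n)%nat at 3; rewrite jacobi_coef_add.
  unfold jcoef; change (INR 0) with 0; rewrite Rplus_0_r.
  change (pochhammer (a + b + INR (0 + S n) + 1) 0) with 1.
  change (INR (fact 0)) with 1; rewrite pow_O; field; exact Hf.
- unfold sum_f; replace (S n - 1)%nat with n by lia.
  rewrite scal_sum; apply sum_eq; intros k Hk.
  replace (k + 1)%nat with (S k) by lia.
  remember (S k) as i; assert (Hi : (i <= S n)%nat) by lia.
  remember (S n - i)%nat as j; replace (S n) with (i + j)%nat in * by lia.
  rewrite jacobi_coef_add; unfold jcoef, Binomial.C.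
  replace (i + j - i)%nat with j by lia.
  rewrite pochhammer_add.
  replace (a + 1 + INR i) with (a + INR i + 1) by ring.
  assert (pochhammer (a + 1) i <> 0)
    by (apply Rgt_not_eq, pochhammer_pos; lra).
  field; repeat split; trivial; apply INR_fact_neq_0.
Qed.

(** * Lowering relation for the derivative *)

(** The first factor of (a+b+n+2)_(k+1) comes out, leaving (a+b+n+3)_k, which is the symbol for
    parameters [a + 1], [b + 1] in degree [n]; [S k] cancels against the factorial. *)
Lemma jacobi_coef_lower (a b : R) (n k : nat) : (k <= n)%nat ->
  INR (S k) * jacobi_coef a b (S n) (S k) =
  (a + b + INR (S n) + 1) * jacobi_coef (a + 1) (b + 1) n k.
Proof.
intros Hk; replace n with (k + (n - k))%nat by lia.
generalize (n - k)%nat as j; intros j.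
change (S (k + j)) with (S k + j)%nat; rewrite !jacobi_coef_add.
unfold jcoef; rewrite pochhammer_S_l, fact_simpl, mult_INR.
change (S k + j)%nat with (S (k + j)); rewrite !S_INR.
replace (a + b + (INR (k + j) + 1) + 1 + 1)
  with (a + 1 + (b + 1) + INR (k + j) + 1) by ring.
replace (a + (INR k + 1) + 1) with (a + 1 + INR k + 1) by ring.
pose proof (pos_INR k).
field; repeat split; try apply INR_fact_neq_0; lra.
Qed.

(** The derivative is taken in [t]; the factor 1/2 for the variable [x] enters later through the
    chain rule. The branch [O] agrees with P_(-1) = 0. *)
Definition jacobi_sum' (a b : R) (n : nat) (t : R) : R :=
  match n with
  | O => 0
  | S m => (a + b + INR n + 1) * jacobi_sum (a + 1) (b + 1) m t
  end.

Lemma is_derive_jacobi_sum (a b : R) (n : nat) (t : R) :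
  is_derive (jacobi_sum a b n) t (jacobi_sum' a b n t).
Proof.
destruct n as [|n].
- apply (is_derive_ext (fun _ => 1)); [intros u; now rewrite jacobi_sum_0|].
  apply (is_derive_const 1).
- unfold jacobi_sum', jacobi_sum; rewrite poly_sum_scal.
  rewrite <- (poly_sum_ext _ _ _ _ (jacobi_coef_lower a b n)).
  apply is_derive_poly_sum.
Qed.

(** The Euler operator t d/dt multiplies the coefficient of [t ^ k] by [k], so the degree is kept
    and no index shift remains. *)
Lemma mul_jacobi_sum' (a b : R) (n : nat) (t : R) :
  t * jacobi_sum' a b n t =
  poly_sum (fun k => INR k * jacobi_coef a b n k) n t.
Proof.
destruct n as [|n]; [unfold poly_sum; simpl; ring|].
unfold jacobi_sum', jacobi_sum; rewrite poly_sum_scal.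
rewrite <- (poly_sum_ext _ _ _ _ (jacobi_coef_lower a b n)), poly_sum_shift.
apply poly_sum_ext; intros [|k] _; simpl shift_coef; [simpl; ring|reflexivity].
Qed.

(** * Raising relation and reflection *)

(** Compares the coefficients of [t ^ k] in [jacobi_sum_raise]. The ends are treated apart: at
    [k = 0] there is no shifted term, at [k = S n] only the shifted term survives, and beyond that
    everything vanishes. *)
Lemma jacobi_coef_raise (a b : R) (n k : nat) :
  (INR k + a + 1) * jacobi_coef (a + 1) (b + 1) n k
  + shift_coef (fun i => (INR i + a + b + 2) * jacobi_coef (a + 1) (b + 1) n i) k
  = INR (S n) * jacobi_coef a b (S n) k.
Proof.
destruct (Nat.lt_ge_cases (S n) k) as [Hk|Hk].
- rewrite !jacobi_coef_gt by lia; destruct k as [|k]; [lia|].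
  simpl shift_coef; rewrite !jacobi_coef_gt by lia; ring.
- destruct k as [|k]; simpl shift_coef.
  + change (S n) with (0 + S n)%nat at 2; change n with (0 + n)%nat at 1.
    rewrite !jacobi_coef_add; unfold jcoef.
    rewrite fact_simpl, mult_INR, pochhammer_S_l.
    change (INR 0) with 0; rewrite !Rplus_0_r.
    simpl pochhammer at 1 3.
    pose proof (INR_fact_neq_0 n); pose proof (not_0_INR (S n)).
    change (INR (fact 0)) with 1; field; auto.
  + assert (Hab : forall i j, a + 1 + (b + 1) + INR (i + j) + 1
        = a + b + INR (i + j) + 3) by (intros; ring).
    destruct (Nat.eq_dec n k) as [->|Hn].
    * rewrite jacobi_coef_gt, Rmult_0_r, Rplus_0_l by lia.
      replace (S k) with (S k + 0)%nat at 2 by lia.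
      replace k with (k + 0)%nat at 2 by lia.
      rewrite !jacobi_coef_add; unfold jcoef.
      rewrite !Nat.add_0_r, pochhammer_S_l, fact_simpl, mult_INR, !S_INR.
      replace (a + 1 + (b + 1) + INR k + 1) with (a + b + (INR k + 1) + 1 + 1)
        by ring.
      pose proof (INR_fact_neq_0 k); pose proof (pos_INR k).
      change (INR (fact 0)) with 1; simpl; field; split; lra.
    * replace n with (S k + (n - S k))%nat by lia.
      generalize (n - S k)%nat as j; intros j.
      replace (jacobi_coef (a + 1) (b + 1) (S k + j) k)
        with (jcoef (a + 1) (b + 1) k (S j))
        by (rewrite <- jacobi_coef_add; f_equal; lia).
      replace (jacobi_coef a b (S (S k + j)) (S k)) with (jcoef a b (S k) (S j))
        by (rewrite <- jacobi_coef_add; f_equal; lia).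
      rewrite jacobi_coef_add; unfold jcoef.
      replace (k + S j)%nat with (S k + j)%nat by lia.
      replace (S k + S j)%nat with (S (S k + j)) by lia.
      rewrite !(fact_simpl k), !(fact_simpl j), !mult_INR.
      (* The arguments of the Pochhammer symbols on the two sides differ by 1, so peeling off first
         or last factors brings them to common symbols that [field] treats as atoms. *)
      replace (a + 1 + (b + 1) + INR (S k + j) + 1)
        with (a + b + INR (S (S k + j)) + 1 + 1) by (rewrite S_INR; ring).
      rewrite (pochhammer_S_l (a + b + INR (S (S k + j)) + 1)).
      replace (a + 1 + INR (S k) + 1) with (a + INR (S k) + 1 + 1) by ring.
      replace (a + 1 + INR k + 1) with (a + INR (S k) + 1)
        by (rewrite S_INR; ring).
      rewrite !(pochhammer_S_l (a + INR (S k) + 1)).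
      rewrite pochhammer_S_r.
      change (S k + j)%nat with (S (k + j)).
      rewrite !S_INR, plus_INR.
      pose proof (INR_fact_neq_0 k); pose proof (INR_fact_neq_0 j).
      pose proof (pos_INR k); pose proof (pos_INR j).
      field; repeat split; lra.
Qed.

(** This is the raising relation divided by -2 w_(a,b), using 1 - x = -2t and 1 + x = 2(1 + t). *)
Lemma jacobi_sum_raise (a b : R) (n : nat) (t : R) :
  t * (1 + t) * jacobi_sum' (a + 1) (b + 1) n t
  + ((a + 1) * (1 + t) + (b + 1) * t) * jacobi_sum (a + 1) (b + 1) n t
  = INR (S n) * jacobi_sum a b (S n) t.
Proof.
(* With E = t d/dt the left side is (E + a + 1) q + t (E + a + b + 2) q: one diagonal part and one
   shifted part. *)
set (q := jacobi_coef (a + 1) (b + 1) n).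
transitivity
  ((poly_sum (fun k => INR k * q k) n t + (a + 1) * poly_sum q n t)
   + t * (poly_sum (fun k => INR k * q k) n t + (a + b + 2) * poly_sum q n t)).
{ unfold q; rewrite <- mul_jacobi_sum'; unfold jacobi_sum; ring. }
rewrite !poly_sum_scal, !poly_sum_plus, poly_sum_shift.
rewrite poly_sum_S by (unfold q; rewrite jacobi_coef_gt by lia; ring).
unfold jacobi_sum; rewrite poly_sum_plus, poly_sum_scal.
apply poly_sum_ext; intros k _.
rewrite <- jacobi_coef_raise; unfold q; destruct k; simpl shift_coef; ring.
Qed.

(* Replacing [x] by [- x] replaces [t = (x - 1) / 2] by [- 1 - t]. *)
Lemma jacobi_sum_reflect (n : nat) : forall a b t,
  jacobi_sum a b n (- 1 - t) = (-1) ^ n * jacobi_sum b a n t.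
Proof.
enough (H : (forall a b t,
    jacobi_sum a b n (- 1 - t) = (-1) ^ n * jacobi_sum b a n t) /\
  forall a b t,
    jacobi_sum a b (S n) (- 1 - t) = (-1) ^ S n * jacobi_sum b a (S n) t)
  by apply H.
induction n as [|n [IH1 IH2]].
- split; intros a b t; [rewrite !jacobi_sum_0; simpl; ring|].
  apply (Rmult_eq_reg_l (INR 1)); [|simpl; lra].
  rewrite <- jacobi_sum_raise.
  replace (INR 1 * ((-1) ^ 1 * jacobi_sum b a 1 t))
    with ((-1) ^ 1 * (INR 1 * jacobi_sum b a 1 t)) by ring.
  rewrite <- jacobi_sum_raise, !jacobi_sum_0; simpl; ring.
- split; [exact IH2|]; intros a b t.
  apply (Rmult_eq_reg_l (INR (S (S n)))); [|apply not_0_INR; lia].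
  rewrite <- jacobi_sum_raise, IH2.
  replace (INR (S (S n)) * ((-1) ^ S (S n) * jacobi_sum b a (S (S n)) t))
    with ((-1) ^ S (S n) * (INR (S (S n)) * jacobi_sum b a (S (S n)) t)) by ring.
  (* Under t -> -1 - t the factor t(1 + t) is invariant, while the linear factor changes sign and
     exchanges [a] and [b]. The derivative of degree [S n] involves degree [n], hence [IH1]. *)
  rewrite <- jacobi_sum_raise; unfold jacobi_sum'; rewrite IH1.
  simpl pow; ring.
Qed.

(** * Three-term recurrence *)

(** Coefficient of [t ^ S k] in degree n = k + j + 3, where all four coefficients lie within their
    degrees. Every Pochhammer symbol is reduced to the two common symbols (u+1)_k and (a+k+2)_j,
    after which a rational identity remains. *)
Lemma jacobi_coef_rec_generic (a b : R) (k j : nat) :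
  let n := INR k + INR j + 3 in
  rec_A n a b * jcoef a b (S k) (S (S j)) =
  (rec_B 1 n a b * jcoef a b (S k) (S j)
   + 2 * ((2 * n + a + b - 1) * (2 * n + a + b) * (2 * n + a + b - 2))
     * jcoef a b k (S (S j)))
  - rec_C n a b * jcoef a b (S k) j.
Proof.
intros n; unfold n, jcoef, rec_A, rec_B, rec_C.
replace (S k + S (S j))%nat with (k + j + 3)%nat by lia.
replace (S k + S j)%nat with (k + j + 2)%nat by lia.
replace (k + S (S j))%nat with (k + j + 2)%nat by lia.
replace (S k + j)%nat with (k + j + 1)%nat by lia.
rewrite !(fact_simpl k), !(fact_simpl (S j)), !(fact_simpl j), !mult_INR.
rewrite !plus_INR, !S_INR; change (INR 0) with 0.
set (K := INR k); set (J := INR j).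
set (u := a + b + K + J + 2).
replace (a + b + (K + J + (0 + 1 + 1 + 1)) + 1) with (u + 1 + 1)
  by (unfold u; ring).
replace (a + b + (K + J + (0 + 1 + 1)) + 1) with (u + 1) by (unfold u; ring).
replace (a + b + (K + J + (0 + 1)) + 1) with u by (unfold u; ring).
replace (a + (K + 1) + 1) with (a + K + 1 + 1) by ring.
rewrite (pochhammer_S_l u), (pochhammer_S_r (u + 1)).
rewrite (pochhammer_S_l (a + K + 1)).
rewrite !(pochhammer_S_r (a + K + 1 + 1)), S_INR.
fold K J.
(* [u + 1] may vanish, but it is a factor of [rec_A n a b]. *)
assert (Hu : (u + 1) * pochhammer (u + 1 + 1) (S k)
  = pochhammer (u + 1) k * (u + 1 + K) * (u + 1 + K + 1)).
{ rewrite <- pochhammer_S_l, !pochhammer_S_r, S_INR; unfold K; ring. }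
assert (HK : 0 <= K) by apply pos_INR; assert (HJ : 0 <= J) by apply pos_INR.
assert (Hk : INR (fact k) <> 0) by apply INR_fact_neq_0.
assert (Hj : INR (fact j) <> 0) by apply INR_fact_neq_0.
replace (2 * (K + J + 3) * (K + J + 3 + a + b) * (2 * (K + J + 3) + a + b - 2))
  with (2 * (K + J + 3) * (2 * (K + J + 3) + a + b - 2) * (u + 1))
  by (unfold u; ring).
match goal with |- ?x * (u + 1) * (?p * ?q / ?d) = _ =>
  replace (x * (u + 1) * (p * q / d)) with (x * ((u + 1) * p) * q / d)
    by (unfold Rdiv; ring) end.
rewrite Hu; unfold u; field; repeat split; lra.
Qed.

(** With n = m + 2, the boundary exponents 0, n - 1 and n lack some of the terms and are computed
    separately; above n all terms vanish, and the remaining exponents are generic. *)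
Lemma jacobi_coef_rec (a b : R) (m k : nat) :
  let n := INR (S (S m)) in
  rec_A n a b * jacobi_coef a b (S (S m)) k =
  (rec_B 1 n a b * jacobi_coef a b (S m) k
   + 2 * ((2 * n + a + b - 1) * (2 * n + a + b) * (2 * n + a + b - 2))
     * shift_coef (jacobi_coef a b (S m)) k)
  - rec_C n a b * jacobi_coef a b m k.
Proof.
intros n; unfold n; destruct k as [|i]; simpl shift_coef.
- change (jacobi_coef a b (S (S m)) 0) with (jcoef a b 0 (S (S m))).
  change (jacobi_coef a b (S m) 0) with (jcoef a b 0 (S m)).
  replace (jacobi_coef a b m 0) with (jcoef a b 0 m)
    by (rewrite <- jacobi_coef_add; reflexivity).
  unfold jcoef, rec_A, rec_B, rec_C.
  rewrite !(pochhammer_S_r (a + INR 0 + 1)), !pochhammer_O.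
  rewrite !(fact_simpl (S m)), !(fact_simpl m), !mult_INR, !S_INR.
  change (INR (fact 0)) with 1; change (INR 0) with 0.
  pose proof (INR_fact_neq_0 m); pose proof (pos_INR m).
  field; repeat split; lra.
- destruct (lt_eq_lt_dec m i) as [[Hm| ->]|Hm].
  + destruct (Nat.eq_dec i (S m)) as [->|Hi].
    * rewrite (jacobi_coef_gt a b (S m)), (jacobi_coef_gt a b m) by lia.
      replace (jacobi_coef a b (S (S m)) (S (S m)))
        with (jcoef a b (S (S m)) 0)
        by (rewrite <- jacobi_coef_add; f_equal; lia).
      replace (jacobi_coef a b (S m) (S m)) with (jcoef a b (S m) 0)
        by (rewrite <- jacobi_coef_add; f_equal; lia).
      unfold jcoef, rec_A, rec_B, rec_C; rewrite !Nat.add_0_r, !pochhammer_O.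
      replace (a + b + INR (S (S m)) + 1) with (a + b + INR (S m) + 1 + 1)
        by (rewrite (S_INR (S m)); ring).
      rewrite (pochhammer_S_l (a + b + INR (S m) + 1)).
      set (v := a + b + INR (S m) + 1).
      assert (Hv : v * pochhammer (v + 1) (S (S m)) =
        pochhammer (v + 1) m * v * (v + 1 + INR m) * (v + 2 + INR m))
        by (rewrite !pochhammer_S_r, S_INR; ring).
      replace (2 * INR (S (S m)) * (INR (S (S m)) + a + b)
               * (2 * INR (S (S m)) + a + b - 2))
        with (2 * INR (S (S m)) * (2 * INR (S (S m)) + a + b - 2) * v)
        by (unfold v; rewrite !S_INR; ring).
      match goal with |- ?x * v * (?p * 1 / ?d) = _ =>
        replace (x * v * (p * 1 / d)) with (x * (v * p) / d)
          by (unfold Rdiv; ring) end.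
      rewrite Hv, (fact_simpl (S m)), mult_INR; unfold v; rewrite !S_INR.
      change (INR (fact 0)) with 1.
      pose proof (INR_fact_neq_0 (S m)); pose proof (pos_INR m).
      field; repeat split; lra.
    * rewrite !jacobi_coef_gt by lia; ring.
  + rewrite (jacobi_coef_gt a b i (S i)) by lia.
    replace (jacobi_coef a b (S (S i)) (S i)) with (jcoef a b (S i) 1)
      by (rewrite <- jacobi_coef_add; f_equal; lia).
    replace (jacobi_coef a b (S i) (S i)) with (jcoef a b (S i) 0)
      by (rewrite <- jacobi_coef_add; f_equal; lia).
    replace (jacobi_coef a b (S i) i) with (jcoef a b i 1)
      by (rewrite <- jacobi_coef_add; f_equal; lia).
    unfold jcoef, rec_A, rec_B, rec_C.
    rewrite !Nat.add_0_r, !Nat.add_1_r.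
    rewrite !pochhammer_S_r, !pochhammer_O.
    replace (a + b + INR (S (S i)) + 1) with (a + b + INR (S i) + 1 + 1)
        by (rewrite (S_INR (S i)); ring).
    set (v := a + b + INR (S i) + 1).
    (* Here [v] is n + a + b, a factor of [rec_A]. Absorbing it turns (v+1)_i into (v)_i without
       dividing by [v], which may be zero. *)
    assert (Hv : v * pochhammer (v + 1) i = pochhammer v i * (v + INR i))
      by (rewrite <- pochhammer_S_l, pochhammer_S_r; reflexivity).
    replace (2 * INR (S (S i)) * (INR (S (S i)) + a + b)
               * (2 * INR (S (S i)) + a + b - 2))
      with (2 * INR (S (S i)) * (2 * INR (S (S i)) + a + b - 2) * v)
      by (unfold v; rewrite !S_INR; ring).
    match goal with |- ?x * v * (?p * ?q * ?y / ?d) = _ =>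
      replace (x * v * (p * q * y / d)) with (x * (v * p) * q * y / d)
        by (unfold Rdiv; ring) end.
    rewrite Hv, (fact_simpl i), mult_INR; unfold v; rewrite !S_INR.
    change (INR (fact 0)) with 1; change (INR (fact 1)) with 1.
    change (INR 0) with 0.
    pose proof (INR_fact_neq_0 i); pose proof (pos_INR i).
    field; repeat split; lra.
  + replace m with (S i + (m - S i))%nat by lia.
    generalize (m - S i)%nat as j; intros j.
    replace (jacobi_coef a b (S (S (S i + j))) (S i))
      with (jcoef a b (S i) (S (S j)))
      by (rewrite <- jacobi_coef_add; f_equal; lia).
    replace (jacobi_coef a b (S (S i + j)) (S i)) with (jcoef a b (S i) (S j))
      by (rewrite <- jacobi_coef_add; f_equal; lia).
    replace (jacobi_coef a b (S (S i + j)) i) with (jcoef a b i (S (S j)))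
      by (rewrite <- jacobi_coef_add; f_equal; lia).
    rewrite jacobi_coef_add.
    replace (INR (S (S (S i + j)))) with (INR i + INR j + 3)
      by (rewrite !S_INR, plus_INR, S_INR; ring).
    apply jacobi_coef_rec_generic.
Qed.

(** Since x = 1 + 2t, [rec_B] is affine in [t], and multiplication by [t] shifts coefficients. Once
    all sums are padded with zeros to the same length, the relation holds coefficient by
    coefficient. *)
Lemma jacobi_sum_rec (a b : R) (m : nat) (x : R) :
  rec_A (INR (S (S m))) a b * jacobi_sum a b (S (S m)) ((x - 1) / 2) =
  rec_B x (INR (S (S m))) a b * jacobi_sum a b (S m) ((x - 1) / 2)
  - rec_C (INR (S (S m))) a b * jacobi_sum a b m ((x - 1) / 2).
Proof.
set (n := INR (S (S m))); set (t := (x - 1) / 2).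
set (d := 2 * ((2 * n + a + b - 1) * (2 * n + a + b) * (2 * n + a + b - 2))).
replace (rec_B x n a b) with (rec_B 1 n a b + d * t)
  by (unfold rec_B, d, t; field).
transitivity (rec_B 1 n a b * jacobi_sum a b (S m) t
  + d * (t * jacobi_sum a b (S m) t) + - rec_C n a b * jacobi_sum a b m t);
  [|ring].
unfold jacobi_sum; rewrite poly_sum_shift.
rewrite (poly_sum_S _ (S m)) by (apply jacobi_coef_gt; lia).
rewrite (poly_sum_S _ m) by (apply jacobi_coef_gt; lia).
rewrite (poly_sum_S _ (S m)) by (apply jacobi_coef_gt; lia).
rewrite !poly_sum_scal, !poly_sum_plus; apply poly_sum_ext; intros k _.
unfold d, n; rewrite jacobi_coef_rec; ring.
Qed.

(** * The weight and Rodrigues' formula *)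

Lemma is_derive_recenter (f : R -> R) (y l : R) :
  is_derive f ((y - 1) / 2) l ->
  is_derive (fun x => f ((x - 1) / 2)) y (/ 2 * l).
Proof.
intros H; apply (is_derive_comp f (fun x => (x - 1) / 2) y l (/ 2)); [exact H|].
auto_derive; [trivial|field].
Qed.

(** By the product rule and w_(a+1,b+1) = (1 - y)(1 + y) w_(a,b), the derivative is -2 w_(a,b) times
    the left side of [jacobi_sum_raise]. *)
Lemma jacobi_weight_raise (a b : R) (n : nat) (y : R) : -1 < y < 1 ->
  is_derive (fun x => jacobi_weight (a + 1) (b + 1) x
                      * jacobi_sum (a + 1) (b + 1) n ((x - 1) / 2)) y
    (- 2 * INR (S n) * jacobi_weight a b y
     * jacobi_sum a b (S n) ((y - 1) / 2)).
Proof.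
intros Hy.
assert (HP : is_derive (fun x => jacobi_sum (a + 1) (b + 1) n ((x - 1) / 2)) y
  (/ 2 * jacobi_sum' (a + 1) (b + 1) n ((y - 1) / 2)))
  by apply is_derive_recenter, is_derive_jacobi_sum.
assert (HW : is_derive (jacobi_weight (a + 1) (b + 1)) y
  ((b + 1) * (1 - y) * jacobi_weight a b y
   - (a + 1) * (1 + y) * jacobi_weight a b y)).
{ unfold jacobi_weight, Rpower; auto_derive; [repeat split; lra|].
  rewrite !(Rmult_plus_distr_r _ 1), !exp_plus, !Rmult_1_l, !exp_ln by lra.
  fold (1 - y); field; lra. }
replace (- 2 * INR (S n) * jacobi_weight a b y
     * jacobi_sum a b (S n) ((y - 1) / 2))
  with (((b + 1) * (1 - y) * jacobi_weight a b y
         - (a + 1) * (1 + y) * jacobi_weight a b y)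
        * jacobi_sum (a + 1) (b + 1) n ((y - 1) / 2)
        + jacobi_weight (a + 1) (b + 1) y
          * (/ 2 * jacobi_sum' (a + 1) (b + 1) n ((y - 1) / 2))).
- refine (is_derive_mult (jacobi_weight (a + 1) (b + 1))
    (fun x => jacobi_sum (a + 1) (b + 1) n ((x - 1) / 2)) y _ _ HW HP _).
  intros; apply Rmult_comm.
- replace (-2 * INR (S n) * jacobi_weight a b y
           * jacobi_sum a b (S n) ((y - 1) / 2))
    with (-2 * jacobi_weight a b y
          * (INR (S n) * jacobi_sum a b (S n) ((y - 1) / 2))) by ring.
  rewrite <- jacobi_sum_raise.
  replace (jacobi_weight (a + 1) (b + 1) y)
    with ((1 - y) * (1 + y) * jacobi_weight a b y)
    by (unfold jacobi_weight; rewrite !Rpower_plus, !Rpower_1 by lra; ring).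
  field.
Qed.

Lemma locally_open_unit (y : R) : -1 < y < 1 ->
  locally y (fun z => -1 < z < 1).
Proof.
intros Hy; apply (locally_interval _ y (-1) 1); simpl; try lra.
intros; lra.
Qed.

(** Rodrigues' formula before division by the weight. The induction varies [a] and [b]: the first
    [m] derivatives lead to the parameters [a + 1], [b + 1], and the last one is
    [jacobi_weight_raise]. *)
Lemma jacobi_weight_derive_n (m : nat) : forall a b y, -1 < y < 1 ->
  is_derive_n (jacobi_weight (a + INR m) (b + INR m)) m y
    ((- 2) ^ m * INR (fact m) * jacobi_weight a b y
     * jacobi_sum a b m ((y - 1) / 2)).
Proof.
induction m as [|m IH]; intros a b y Hy.
- simpl; rewrite jacobi_sum_0, !Rplus_0_r; ring.
- replace (a + INR (S m)) with (a + 1 + INR m) by (rewrite S_INR; ring).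
  replace (b + INR (S m)) with (b + 1 + INR m) by (rewrite S_INR; ring).
  change (is_derive
    (Derive_n (jacobi_weight (a + 1 + INR m) (b + 1 + INR m)) m) y
    ((- 2) ^ S m * INR (fact (S m)) * jacobi_weight a b y
     * jacobi_sum a b (S m) ((y - 1) / 2))).
  (* The formula for the [m]-th derivative is known only on (-1, 1), so it is substituted on a
     neighbourhood of [y]. *)
  apply (is_derive_ext_loc (fun x => ((- 2) ^ m * INR (fact m))
    * (jacobi_weight (a + 1) (b + 1) x
       * jacobi_sum (a + 1) (b + 1) m ((x - 1) / 2)))).
  + apply (filter_imp (fun z => -1 < z < 1)); [|now apply locally_open_unit].
    intros z Hz; symmetry; rewrite <- Rmult_assoc.
    now apply is_derive_n_unique, IH.
  + replace ((- 2) ^ S m * INR (fact (S m)) * jacobi_weight a b y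
             * jacobi_sum a b (S m) ((y - 1) / 2))
      with ((- 2) ^ m * INR (fact m) * (- 2 * INR (S m) * jacobi_weight a b y
             * jacobi_sum a b (S m) ((y - 1) / 2)))
      by (rewrite fact_simpl, mult_INR; simpl pow; ring).
    apply is_derive_scal, jacobi_weight_raise, Hy.
Qed.

(** The factor (1 - y^2)^n raises both exponents of the weight by [n], which is the form that
    [jacobi_weight_derive_n] differentiates. *)
Lemma ln_exp_pow_jacobi_weight (a b : R) (n : nat) (y : R) : -1 < y < 1 ->
  ln (exp ((1 - y ^ 2) ^ n * jacobi_weight a b y)) =
  jacobi_weight (a + INR n) (b + INR n) y.
Proof.
intros Hy; rewrite ln_exp; unfold jacobi_weight.
replace (1 - y ^ 2) with ((1 - y) * (1 + y)) by ring.
rewrite Rpow_mult_distr, !Rpower_plus, !Rpower_pow by lra; ring.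
Qed.

(** * Passage to exponentials *)

Lemma is_mderive_exp (f : R -> R) (x l : R) :
  is_derive f x l -> is_mderive (fun y => exp (f y)) x (exp l).
Proof.
intros H.
replace (exp l) with (mderive_n (fun y => exp (f y)) 1 x).
- apply is_mderive_mderive_1; [intros; apply exp_pos|split].
  + apply filter_forall; intros y [|k] Hk; [exact I|lia].
  + exists l; simpl; apply (is_derive_ext f); [|exact H].
    intros; symmetry; apply ln_exp.
- unfold mderive_n; f_equal; simpl; apply is_derive_unique.
  apply (is_derive_ext f); [|exact H]; intros; symmetry; apply ln_exp.
Qed.

Lemma Rpower_exp (u v : R) : Rpower (exp u) v = exp (v * u).
Proof. unfold Rpower; now rewrite ln_exp. Qed.

Lemma prod_f_R0_exp (a : nat -> R) (n : nat) (x : R) :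
  prod_f_R0 (fun k => Rpower (exp (a k)) (x ^ k)) n = exp (poly_sum a n x).
Proof.
unfold poly_sum; induction n as [|n IH]; simpl prod_f_R0; simpl sum_f_R0.
- rewrite Rpower_exp; f_equal; ring.
- rewrite IH, exp_plus, Rpower_exp; f_equal; f_equal; ring.
Qed.

(** * Value at x = 1 and leading coefficient *)

(** The point [t = 0] is x = 1; only the constant term (a+1)_n / n! remains there. *)
Lemma jacobi_sum_at_0 (a b : R) (n : nat) :
  jacobi_sum a b n 0 = gbinom (INR n + a) n.
Proof.
unfold jacobi_sum, poly_sum.
transitivity (jcoef a b 0 n).
- rewrite <- jacobi_coef_add; destruct n as [|n]; [simpl; ring|].
  rewrite decomp_sum by lia; simpl pred.
  rewrite (sum_eq _ (fun _ => 0)) by (intros; simpl; ring).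
  rewrite sum_cte, pow_O; simpl Nat.add; ring.
- unfold jcoef, gbinom; rewrite falling_pochhammer, pochhammer_O.
  change (INR (fact 0)) with 1; change (INR 0) with 0.
  replace (INR n + a - INR n + 1) with (a + 0 + 1) by ring.
  field; apply INR_fact_neq_0.
Qed.

Lemma jacobi_coef_lead (a b : R) (n : nat) :
  jacobi_coef a b n n = gbinom (2 * INR n + a + b) n.
Proof.
transitivity (jcoef a b n 0).
- rewrite <- jacobi_coef_add; f_equal; lia.
- unfold jcoef, gbinom; rewrite falling_pochhammer, pochhammer_O, Nat.add_0_r.
  change (INR (fact 0)) with 1.
  replace (2 * INR n + a + b - INR n + 1) with (a + b + INR n + 1) by ring.
  field; apply INR_fact_neq_0.
Qed.

Theorem proposition4p2 (alpha beta : R)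
  (halpha : -1 < alpha) (hbeta : -1 < beta) :
  (forall (n : nat) (x : R),
     is_mderive (mjacobi alpha beta (Z.of_nat n)) x
       (Rpower (mjacobi (alpha + 1) (beta + 1) (Z.of_nat n - 1) x)
          (1 / 2 * (INR n + alpha + beta + 1))) /\
     is_derive (mjacobi alpha beta (Z.of_nat n)) x
       (1 / 2 * (INR n + alpha + beta + 1)
        * jacobi (alpha + 1) (beta + 1) (Z.of_nat n - 1) x
        * mjacobi alpha beta (Z.of_nat n) x)) /\
  (forall (n : nat) (x : R), -1 < x < 1 ->
     ex_mderive_n
       (fun y => exp ((1 - y ^ 2) ^ n * jacobi_weight alpha beta y)) n x /\
     mjacobi alpha beta (Z.of_nat n) x =
       Rpower
         (mderive_n
            (fun y => exp ((1 - y ^ 2) ^ n * jacobi_weight alpha beta y)) n x)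
         (1 / ((-1) ^ n * INR (fact n) * 2 ^ n
               * jacobi_weight alpha beta x))) /\
  ((forall (n : nat) (x : R), (1 <= n)%nat ->
      Rpower (mjacobi alpha beta (Z.of_nat n) x) (rec_A (INR n) alpha beta) =
      Rpower (mjacobi alpha beta (Z.of_nat n - 1) x)
             (rec_B x (INR n) alpha beta)
      / Rpower (mjacobi alpha beta (Z.of_nat n - 2) x)
               (rec_C (INR n) alpha beta)) /\
   (forall x : R, mjacobi alpha beta 0 x = exp 1) /\
   (forall x : R, mjacobi alpha beta (-1) x = 1)) /\
  (forall n : nat,
     mjacobi alpha beta (Z.of_nat n) 1 = exp (gbinom (INR n + alpha) n) /\
     forall x : R,
       mjacobi alpha beta (Z.of_nat n) (- x) =
       Rpower (mjacobi beta alpha (Z.of_nat n) x) ((-1) ^ n)) /\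
  (forall n : nat,
     is_mult_poly (mjacobi alpha beta (Z.of_nat n)) n
       (exp (1 / 2 ^ n * gbinom (2 * INR n + alpha + beta) n))).
Proof.
assert (Hder : forall n x, is_derive (jacobi alpha beta (Z.of_nat n)) x
  (1 / 2 * (INR n + alpha + beta + 1)
   * jacobi (alpha + 1) (beta + 1) (Z.of_nat n - 1) x)).
{ intros n x.
  apply (is_derive_ext (fun y => jacobi_sum alpha beta n ((y - 1) / 2)));
    [intros; symmetry; now apply jacobi_jacobi_sum|].
  replace (1 / 2 * (INR n + alpha + beta + 1)
   * jacobi (alpha + 1) (beta + 1) (Z.of_nat n - 1) x)
    with (/ 2 * jacobi_sum' alpha beta n ((x - 1) / 2)).
  - apply is_derive_recenter, is_derive_jacobi_sum.
  (* For [n = 0] both sides vanish, because the index -1 gives the zero polynomial. *)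
  - destruct n as [|n]; [simpl; ring|].
    replace (Z.of_nat (S n) - 1)%Z with (Z.of_nat n) by lia.
    rewrite jacobi_jacobi_sum by lra; unfold jacobi_sum'; field. }
split; [|split; [|split; [|split]]].
- intros n x; split.
  + unfold mjacobi at 2; rewrite Rpower_exp; apply is_mderive_exp, Hder.
  + rewrite Rmult_comm.
    replace (mjacobi alpha beta (Z.of_nat n) x
      * (1 / 2 * (INR n + alpha + beta + 1)
         * jacobi (alpha + 1) (beta + 1) (Z.of_nat n - 1) x))
      with (scal (1 / 2 * (INR n + alpha + beta + 1)
         * jacobi (alpha + 1) (beta + 1) (Z.of_nat n - 1) x)
         (mjacobi alpha beta (Z.of_nat n) x))
      by (unfold scal; simpl; unfold mult; simpl; ring).
    apply (is_derive_comp exp); [apply is_derive_exp|apply Hder].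
- intros n x Hx.
  set (g := fun t => ln (exp ((1 - t ^ 2) ^ n * jacobi_weight alpha beta t))).
  assert (Hg : forall y, -1 < y < 1 -> locally y (fun t =>
    jacobi_weight (alpha + INR n) (beta + INR n) t = g t)).
  { intros y Hy; apply (filter_imp (fun z => -1 < z < 1));
      [|now apply locally_open_unit].
    intros z Hz; symmetry; now apply ln_exp_pow_jacobi_weight. }
  assert (Hex : forall k y, (k <= n)%nat -> -1 < y < 1 -> ex_derive_n g k y).
  { intros k y Hk Hy.
    apply (ex_derive_n_ext_loc _ _ _ _ (Hg y Hy)).
    (* Writing n = (n - k) + k lets the formula for order [k] apply with base parameters raised by n
       - k. *)
    replace (alpha + INR n) with (alpha + INR (n - k) + INR k)
      by (rewrite minus_INR by lia; ring).
    replace (beta + INR n) with (beta + INR (n - k) + INR k)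
      by (rewrite minus_INR by lia; ring).
    pose proof (jacobi_weight_derive_n k (alpha + INR (n - k))
      (beta + INR (n - k)) y Hy) as H.
    destruct k as [|k]; [exact I|eexists; exact H]. }
  split; [split|].
  + apply (filter_imp (fun z => -1 < z < 1)); [|now apply locally_open_unit].
    intros y Hy k Hk; apply Hex; [lia|exact Hy].
  + now apply Hex.
  + unfold mderive_n, mjacobi; fold g; rewrite Rpower_exp; f_equal.
    rewrite <- (Derive_n_ext_loc _ _ n x (Hg x Hx)).
    rewrite (is_derive_n_unique _ _ _ _
      (jacobi_weight_derive_n n alpha beta x Hx)).
    rewrite jacobi_jacobi_sum by lra.
    replace (-2) with (-1 * 2) by ring; rewrite Rpow_mult_distr.
    assert (jacobi_weight alpha beta x <> 0)
      by (apply Rgt_not_eq, Rmult_lt_0_compat; apply exp_pos).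
    pose proof (INR_fact_neq_0 n).
    field; repeat split; trivial; apply pow_nonzero; lra.
- split; [|split; [reflexivity|intros; apply exp_0]].
  intros n x Hn; unfold mjacobi; rewrite !Rpower_exp.
  unfold Rdiv at 1; rewrite <- exp_Ropp, <- exp_plus; f_equal.
  (* Degree 1 is checked by hand: it involves the index -1, which is not a [jacobi_sum]. *)
  destruct n as [|[|m]]; [lia| |].
  + change (jacobi alpha beta (Z.of_nat 1 - 1) x) with 1.
    change (jacobi alpha beta (Z.of_nat 1 - 2) x) with 0.
    rewrite jacobi_jacobi_sum by lra.
    unfold jacobi_sum, poly_sum, jacobi_coef, jcoef, rec_A, rec_B; simpl; field.
  + replace (Z.of_nat (S (S m)) - 1)%Z with (Z.of_nat (S m)) by lia.
    replace (Z.of_nat (S (S m)) - 2)%Z with (Z.of_nat m) by lia.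
    rewrite !jacobi_jacobi_sum, jacobi_sum_rec by lra; ring.
- intros n; split.
  + unfold mjacobi; rewrite jacobi_jacobi_sum by lra.
    replace ((1 - 1) / 2) with 0 by field; now rewrite jacobi_sum_at_0.
  + intros x; unfold mjacobi; rewrite Rpower_exp, !jacobi_jacobi_sum by lra.
    (* The point -x corresponds to -1 - t, since (-x - 1) / 2 = -1 - (x - 1) / 2. *)
    rewrite <- jacobi_sum_reflect; f_equal; f_equal; field.
- intros n; destruct (poly_sum_recenter (jacobi_coef alpha beta n) n)
    as (c & Hn & _ & Hx).
  rewrite jacobi_coef_lead in Hn.
  exists (fun k => exp (c k)); split; [|split; [|split]].
  + intros; apply exp_pos.
  + enough (0 < c n) by (rewrite <- exp_0; intros H0; apply exp_inv in H0; lra).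
    rewrite Hn; apply Rdiv_lt_0_compat; [|apply pow_lt; lra].
    apply Rdiv_lt_0_compat; [|apply INR_fact_lt_0].
    (* The Pochhammer symbol starts at n + alpha + beta + 1, which is positive for n >= 1 because
       alpha + beta > -2. For [n = 0] it may start at a negative number, but the empty product is
       1. *)
    destruct n as [|n]; [simpl; lra|].
    rewrite falling_pochhammer; apply pochhammer_pos.
    rewrite S_INR; pose proof (pos_INR n); lra.
  + rewrite Hn; f_equal; field; apply pow_nonzero; lra.
  + intros x; rewrite prod_f_R0_exp; unfold mjacobi.
    now rewrite jacobi_jacobi_sum by lra; unfold jacobi_sum; rewrite Hx.
Qed.
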